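(* Let $\sigma=\tanh$. Then, for the covariances and metric defined in the context: 1. If $\sigma_w^2=1$, then $\lim_{L\to\infty}\mathrm{FSP}_L(\sigma_w^2)=0$. 2. If $0<\sigma_w^2<1$, then $\mathrm{FSP}_L(\sigma_w^2)\le\frac{C}{d_0}\sigma_w^{2L}$ for every $L\ge1$.
   Context: Let $\mathcal G$ be a finite undirected graph with $n$ nodes, adjacency matrix $A$, degree matrix $D=\mathrm{diag}(A\mathbf 1_n)$, $\tilde A=A+I$, $\tilde D=D+I$, $\hat A=\tilde D^{-1/2}\tilde A\tilde D^{-1/2}$. Let $X\in\mathbb R^{n\times d_0}$ be nonzero, $C\ge1$ an integer, $\sigma_w^2>0$. For positive semidefinite $\Sigma\in\mathbb R^{n\times n}$, $G(\Sigma)=\mathbb E_{h\sim N(\mathbf 0_n,\Sigma)}[\sigma(h)\sigma(h)^\top]$ ($\sigma$ entrywise). Define $\Sigma^{(1)}=\frac{\sigma_w^2}{d_0}\hat AXX^\top\hat A$ and $\Sigma^{(l+1)}=\sigma_w^2\hat AG(\Sigma^{(l)})\hat A$. With $H\in\mathbb R^{n\times C}$ having i.i.d. columns $N(\mathbf 0_n,\Sigma^{(L)})$, $\mathrm{FSP}_L(\sigma_w^2)=\mathbb E[\|H\|_F^2/\|X\|_F^2]$. *)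

(* Defs.v *)
From HB Require Import structures.
From mathcomp Require Import all_boot all_order all_algebra.
From mathcomp Require Import all_classical all_reals all_analysis.
Set Implicit Arguments. Unset Strict Implicit. Unset Printing Implicit Defensive.
Import Order.TTheory GRing.Theory Num.Theory.
Local Open Scope ring_scope.

Section GNN.
Variable R : realType.

Definition tanhR (x : R) : R := (expR x - expR (- x)) / (expR x + expR (- x)).

(* E[f(z)] for z = (z_0,...,z_{k-1}) i.i.d. N(0,1) (iterated integrals against
   the standard normal probability measure); coordinates >= k are set to 0. *)
Fixpoint gexp (k : nat) (f : (nat -> R) -> R) : R :=
  match k with
  | 0 => f (fun _ => 0)
  | k'.+1 => \int[normal_prob (0:R) 1]_x
               gexp k' (fun z => f (fun j => if j == k' then x else z j))
  end.

(* a factor B with B B^T = S (exists iff S is PSD); 0 if none exists.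
   N(0,S) is the law of B z with z ~ N(0, I_n). *)
Definition cov_factor n (S : 'M[R]_n) : 'M[R]_n :=
  match pselect (exists B : 'M[R]_n, B *m B^T = S) with
  | left h => proj1_sig (cid h)
  | right _ => 0
  end.

Definition col_of n (z : nat -> R) : 'cV[R]_n := \col_i z (nat_of_ord i).

Definition Gtanh n (S : 'M[R]_n) : 'M[R]_n :=
  \matrix_(i, j) gexp n (fun z =>
     let h := cov_factor S *m col_of n z in tanhR (h i 0) * tanhR (h j 0)).

Definition deg n (A : 'M[R]_n) (i : 'I_n) : R := \sum_j A i j.
Definition Ahat n (A : 'M[R]_n) : 'M[R]_n :=
  let Dm := diag_mx (\row_i (Num.sqrt (deg A i + 1))^-1) in
  Dm *m (A + 1%:M) *m Dm.

(* Sigma^(L); index 0 unused (set to 0) *)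
Fixpoint Sigma n d0 (A : 'M[R]_n) (X : 'M[R]_(n, d0)) (sw2 : R) (l : nat)
  : 'M[R]_n :=
  match l with
  | 0 => 0
  | l'.+1 =>
      if l' is 0 then (sw2 / d0%:R) *: (Ahat A *m X *m X^T *m Ahat A)
      else sw2 *: (Ahat A *m Gtanh (Sigma A X sw2 l') *m Ahat A)
  end.

Definition frob2 m k (M : 'M[R]_(m, k)) : R := \sum_i \sum_j M i j ^+ 2.

(* FSP_L = E[ ||H||_F^2 / ||X||_F^2 ], H (n x C) with i.i.d. columns
   N(0, Sigma^(L)); column c of H is B z_c where z_c uses coordinates
   c*n .. c*n+n-1 of an i.i.d. N(0,1) family. *)
Definition FSP n d0 (A : 'M[R]_n) (X : 'M[R]_(n, d0)) (C : nat) (sw2 : R)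
  (L : nat) : R :=
  let B := cov_factor (Sigma A X sw2 L) in
  gexp (n * C) (fun z =>
    let H : 'M[R]_(n, C) :=
      \matrix_(i, c) (B *m col_of n (fun j => z (c * n + j)%N)) i 0 in
    frob2 H / frob2 X).

End GNN.

(* Main.v *)
Require Import Defs.
From HB Require Import structures.
From mathcomp Require Import all_boot all_order all_algebra.
From mathcomp Require Import all_classical all_reals all_analysis.
From mathcomp Require Import measurable_realfun ring lra.
Import Order.TTheory GRing.Theory Num.Theory numFieldNormedType.Exports.
Local Open Scope classical_set_scope.
Local Open Scope ring_scope.

(** Let [B_L] be the chosen factor of [Sigma^(L)] and [t_L = ||B_L||_F^2], so
    that [t_L = tr Sigma^(L)] and [FSP_L = C t_L / ||X||_F^2].  Since [Ahat] is
    a contraction, [t_(L+1) <= sw2 * \sum_i E[tanh^2 h_i]].  The pointwise bound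
    [tanh^2 x <= psi (x^2)], with [psi u = u / (1 + u / 2)] concave, and Jensen's
    inequality give [t_(L+1) <= sw2 * n psi (t_L / n)].  For [sw2 < 1] the bound
    [psi u <= u] yields geometric decay; for [sw2 = 1] the recursion forces
    [t_L = O(1 / L)].  Jensen's inequality is applied through tangent lines of
    [psi], so only the first two moments of the Gaussian are needed.  If
    [Sigma^(L)] had no factor, [cov_factor] would be [0] and every bound would
    still hold, so positive semidefiniteness never has to be established. *)

(** * Moments of the standard normal distribution *)

Section StandardNormal.
Context {R : realType}.
Local Notation mu := (@lebesgue_measure R).
Local Notation N := (normal_prob (0 : R) 1).
Local Notation p := (normal_pdf (0 : R) 1).

(** The Radon-Nikodym derivative of the normal law and the density [p] have the same integral over
    every measurable set, so they agree almost everywhere. *)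
Lemma ge0_integral_normal_prob (f : R -> \bar R) :
  (forall x, 0 <= f x)%E -> measurable_fun [set: R] f ->
  (\int[N]_x f x = \int[mu]_x (f x * (p x)%:E))%E.
Proof.
move=> f0 mf.
have dom := normal_prob_dominates (0 : R) 1.
rewrite -(Radon_Nikodym_SigmaFinite.change_of_variables dom)//=.
have int_d := Radon_Nikodym_SigmaFinite.f_integrable dom.
apply: ae_eq_integral => //=.
- by apply: emeasurable_funM => //; exact: (measurable_int mu).
- apply: emeasurable_funM => //; apply/measurable_EFinP.
  exact: measurable_normal_pdf.
- apply: ae_eqe_mul2l; apply: integral_ae_eq => //=.
  + by apply/measurable_EFinP; exact: measurable_normal_pdf.
  + by move=> E _ mE; rewrite -Radon_Nikodym_SigmaFinite.f_integral.
Qed.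

Lemma normal_pdfN (x : R) : p (- x) = p x.
Proof. by rewrite normal_pdfE ?oner_neq0// /normal_fun !subr0 sqrrN. Qed.

Lemma ge0_integralN (f : R -> \bar R) :
  (forall x, 0 <= f x)%E -> measurable_fun [set: R] f ->
  (\int[mu]_x f (- x)%R = \int[mu]_x f x)%E.
Proof.
move=> f0 mf.
rewrite (_ : \int[mu]_x f (- x)%R =
  \int[mu]_(x in (-%R : _ -> measurableTypeR R) @^-1` setT) f (- x)%R)%E//.
rewrite -ge0_integral_pushforward//=.
apply: eq_measure_integral => //= A mA AS; exact: lebesgue_measureN.
Qed.

Lemma ge0_integral_normal_probN (f : R -> \bar R) :
  (forall x, 0 <= f x)%E -> measurable_fun [set: R] f ->
  (\int[N]_x f (- x)%R = \int[N]_x f x)%E.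
Proof.
move=> f0 mf; rewrite !ge0_integral_normal_prob//; last first.
  by apply: measurableT_comp => //.
rewrite -[RHS]ge0_integralN.
- by apply: eq_integral => x _; rewrite normal_pdfN.
- by move=> x; rewrite mule_ge0// lee_fin normal_pdf_ge0.
- by apply: emeasurable_funM => //; apply/measurable_EFinP;
    exact: measurable_normal_pdf.
Qed.

Lemma is_derive_normal_pdf (x : R) : is_derive x 1 p (- x * p x).
Proof.
pose q (x : R) := - (x - 0) ^+ 2 / (1 ^+ 2 *+ 2) : R.
have dq : is_derive x 1 q (- x).
  rewrite /q; apply: is_derive_eq.
  by rewrite /GRing.scale/=; field.
rewrite normal_pdfE ?oner_neq0//.
suff : is_derive x 1 (cst (normal_peak 1) * (expR \o q) : R -> R)
  (- x * (normal_peak 1 * expR (q x))) by [].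
apply: is_derive_eq; rewrite /GRing.scale/=; ring.
Qed.

Lemma continuous_derivable (f : R -> R) :
  (forall x, derivable f x 1) -> continuous f.
Proof. by move=> df x; apply/differentiable_continuous/derivable1_diffP. Qed.

Lemma derivable_LRcontinuous (f : R -> R) (a b : R) :
  (forall x, derivable f x 1) -> derivable_oo_LRcontinuous f a b.
Proof.
move=> df; have cf := continuous_derivable _ df.
by split => //; [apply: cvg_at_right_filter|apply: cvg_at_left_filter];
  exact: cf.
Qed.

(** Integration by parts of [x * (x * p x)], with [- p] as primitive of [x * p x]. The boundary term
    [- a * p a] is nonpositive and is dropped. *)
Lemma integral_itv_sqr_normal_pdf (a : R) : 0 < a ->
  (\int[mu]_(x in `[0%R, a]) (x ^+ 2 * p x)%:E <=
   \int[mu]_(x in `[0%R, a]) (p x)%:E)%E.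
Proof.
move=> a0.
have cp : continuous p.
  by apply: continuous_derivable => x; have [] := is_derive_normal_pdf x.
have dN (x : R) : is_derive x 1 (fun x => - p x) (x * p x).
  have := is_derive_normal_pdf x => dp.
  by apply: is_derive_eq; rewrite mulNr opprK.
under eq_integral do rewrite expr2 -mulrA.
rewrite (@integration_by_parts _ id (fun x => - p x) (cst 1) (fun x => x * p x))//.
- rewrite mul0r subr0 mulrN /=.
  under eq_integral do rewrite mul1r EFinN.
  rewrite integralN/=; last first.
    apply: integrable_add_def => //.
    apply: (@integrableS _ _ _ _ setT) => //.
    exact: integrable_normal_pdf.
  rewrite oppeK EFinN -[leRHS]add0e leeD2r// -EFinN lee_fin oppr_le0.
  by rewrite mulr_ge0// ?normal_pdf_ge0// ltW.
- exact/continuous_subspaceT/cst_continuous.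
- by apply: derivable_LRcontinuous => x.
- by move=> x _; rewrite derive1E derive_id.
- apply: continuous_subspaceT => x; apply: cvgM; [exact: cvg_id|exact: cp].
- by apply: derivable_LRcontinuous => x; have [] := dN x.
- by move=> x _; rewrite derive1E; have [_ ->] := dN x.
Qed.

(** By evenness both sides reduce to the half-line, which is exhausted by the intervals [[0, n]]. *)
Lemma integral_sqr_normal_prob_le1 : (\int[N]_x (x ^+ 2)%:E <= 1)%E.
Proof.
have mp := measurable_normal_pdf (0 : R) 1.
have p0 x : 0 <= p x by exact: normal_pdf_ge0.
have cp : continuous p by exact/continuous_normal_pdf/oner_neq0.
have cp2 : continuous (fun x : R => x ^+ 2 * p x).
  by move=> x; apply: cvgM; [exact: sqr_continuous|exact: cp].
rewrite ge0_integral_normal_prob//; last 2 first.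
- by move=> x; rewrite lee_fin sqr_ge0.
- exact/measurable_EFinP/measurable_funX.
under eq_integral do rewrite -EFinM.
have p20 x : 0 <= x ^+ 2 * p x by rewrite mulr_ge0 ?sqr_ge0.
rewrite -(integral_normal_pdf (0 : R) 1) (ge0_symfun_integralT p20 cp2); last first.
  by move=> x /=; rewrite normal_pdfN sqrrN.
rewrite (ge0_symfun_integralT p0 cp); last by move=> x /=; rewrite normal_pdfN.
apply: lee_wpmul2l => //; rewrite -set_itvcy.
have cv := @ge0_cvgn_integral _ mu _ p20 (continuous_measurable_fun cp2).
rewrite -(cvg_lim _ cv)//; apply: lime_le; first by apply/cvg_ex; eexists; exact: cv.
near=> n; apply: (le_trans (integral_itv_sqr_normal_pdf _ _)).
  by rewrite ltr0n; near: n; exact: nbhs_infty_gt.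
apply: ge0_subset_integral => //=.
- by apply: measurable_funTS; exact/measurable_EFinP.
- by move=> x _; rewrite lee_fin.
- exact: subset_itvl.
Unshelve. all: by end_near. Qed.

Lemma normal_prob_integrable_sqr :
  N.-integrable setT (EFin \o (fun x : R => x ^+ 2)).
Proof.
apply/integrableP; split; first exact/measurable_EFinP/measurable_funX.
under eq_integral do rewrite /= ger0_norm ?sqr_ge0//.
by rewrite (le_lt_trans integral_sqr_normal_prob_le1)// ltry.
Qed.

Lemma normal_prob_integrable_cst (c : R) : N.-integrable setT (EFin \o (cst c)).
Proof. exact: finite_measure_integrable_cst. Qed.

Lemma normal_prob_integrable_quad (f : R -> R) (a b : R) :
  measurable_fun setT f -> (forall x, `|f x| <= a + b * x ^+ 2) ->
  N.-integrable setT (EFin \o f).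
Proof.
move=> mf fab.
apply: (@le_integrable _ _ _ N _ _ _ (EFin \o (fun x => a + b * x ^+ 2))) => //.
- exact/measurable_EFinP.
- by move=> x _ /=; rewrite lee_fin (le_trans (fab x))// ler_norm.
rewrite (_ : _ \o _ = (EFin \o cst a) \+ (fun x => b%:E * (x ^+ 2)%:E))%E.
  apply: integrableD => //; first exact: normal_prob_integrable_cst.
  by apply: integrableZl => //; exact: normal_prob_integrable_sqr.
by apply/funext => x.
Qed.

Lemma Rintegral_normal_prob_sqr_le1 : \int[N]_x (x ^+ 2) <= 1.
Proof.
rewrite /Rintegral -lee_fin fineK; first exact: integral_sqr_normal_prob_le1.
exact: integrable_fin_num normal_prob_integrable_sqr.
Qed.

Lemma Rintegral_normal_prob_cst (c : R) : \int[N]_x c = c.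
Proof.
rewrite Rintegral_cst// [X in fine X](_ : _ = 1%E) ?mulr1//.
exact: probability_setT.
Qed.

Lemma Rintegral_normal_prob_quad (a b c : R) :
  \int[N]_x (a + b * x + c * x ^+ 2) =
  a + b * \int[N]_x x + c * \int[N]_x (x ^+ 2).
Proof.
have i2 := normal_prob_integrable_sqr.
have i1 : N.-integrable setT (EFin \o (fun x : R => x)).
  apply: (@normal_prob_integrable_quad _ 1 1) => // x.
  have := sqr_ge0 (`|x| - 1); rewrite sqrrB mulr1 expr1n real_normK ?num_real//.
  by have := sqr_ge0 x; lra.
have iZ (f : R -> R) d : N.-integrable setT (EFin \o f) ->
    N.-integrable setT (EFin \o (fun x => d * f x)).
  by move=> fi; apply: (integrableZl measurableT d fi).
have iD (f g : R -> R) : N.-integrable setT (EFin \o f) ->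
    N.-integrable setT (EFin \o g) ->
    N.-integrable setT (EFin \o (fun x => f x + g x)).
  by move=> fi gi; apply: (integrableD measurableT fi gi).
rewrite !RintegralD//; last 4 first.
- exact: normal_prob_integrable_cst.
- exact: iZ.
- by apply: iD; [exact: normal_prob_integrable_cst|exact: iZ].
- exact: iZ.
by rewrite !RintegralZl// Rintegral_normal_prob_cst.
Qed.

(* Comparing the second moments of [1 + x] and [1 - x] gives the mean
   without splitting the integral into positive and negative parts. *)
Lemma Rintegral_normal_prob_id : \int[N]_x x = 0.
Proof.
have : \int[N]_x (1 + 2 * x + 1 * x ^+ 2) = \int[N]_x (1 + -2 * x + 1 * x ^+ 2).
  rewrite /Rintegral -ge0_integral_normal_probN//.
  - by congr fine; apply: eq_integral => x _; congr EFin; ring.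
  - by move=> x; rewrite lee_fin; have := sqr_ge0 (1 + x); rewrite sqrrD; lra.
  - apply/measurable_EFinP; apply: measurable_funD; last exact: measurable_funM.
    by apply: measurable_funD => //; exact: measurable_funM.
rewrite !Rintegral_normal_prob_quad; lra.
Qed.

End StandardNormal.

(** * Iterated Gaussian expectations *)

Section GaussianExpectation.
Context {R : realType}.
Local Notation N := (normal_prob (0 : R) 1).

(** Convertible with the substitution inside [gexp], so the successor case of [gexp] unfolds by
    computation. *)
Definition upd (k : nat) (x : R) (z : nat -> R) : nat -> R :=
  fun j => if j == k then x else z j.

(* Measurability for the product sigma-algebra on [nat -> R], expressed through
   its universal property: composition with any family [g] whose coordinates
   are measurable. *)
Definition cylinder_measurable (f : (nat -> R) -> R) :=
  forall (d : measure_display) (T : measurableType d) (g : T -> nat -> R),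
  (forall j, measurable_fun [set: T] (g ^~ j)) ->
  measurable_fun [set: T] (fun t => f (g t)).

(** A growth condition stable under fixing the last coordinate at [x]: the term [b * x ^+ 2] is
    absorbed into the constant [a]. *)
Definition quadratic_growth (k : nat) (f : (nat -> R) -> R) :=
  exists a b : R, 0 <= b /\ forall z, `|f z| <= a + b * \sum_(j < k) z j ^+ 2.

Definition gexpable k f := cylinder_measurable f /\ quadratic_growth k f.

(** Tonelli's theorem applied separately to the positive and negative parts of [F]. *)
Lemma measurable_Rintegral_normal_prob (d : measure_display)
    (T : measurableType d) (F : T * R -> R) :
  measurable_fun setT F ->
  measurable_fun setT (fun t => \int[N]_x F (t, x)).
Proof.
move=> mF; rewrite /Rintegral.
apply: (measurableT_comp (@fine_measurable R setT measurableT)).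
have mF' : measurable_fun setT (EFin \o F) by exact/measurable_EFinP.
rewrite (_ : (fun t => _) = (fun t =>
    fubini_F (N : {sigma_finite_measure set (measurableTypeR R) -> \bar R})
      (EFin \o F)^\+ t -
    fubini_F (N : {sigma_finite_measure set (measurableTypeR R) -> \bar R})
      (EFin \o F)^\- t)%E); last first.
  apply/funext => t; rewrite integralE /fubini_F.
  by congr (_ - _)%E; apply: eq_integral => x _; rewrite !(funeposE, funenegE).
apply: emeasurable_funB; apply: measurable_fun_fubini_tonelli_F => //.
  exact: measurable_funepos.
exact: measurable_funeneg.
Qed.

(** The parameter space [T] is arbitrary so that the induction can move the integration variable
    into it, passing from [T] to [T * R]. *)
Lemma measurable_gexp (k : nat) (d : measure_display) (T : measurableType d)
    (F : T -> (nat -> R) -> R) :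
  (forall (d' : measure_display) (T' : measurableType d') (h : T' -> T)
     (g : T' -> nat -> R), measurable_fun setT h ->
     (forall j, measurable_fun setT (g ^~ j)) ->
     measurable_fun setT (fun t => F (h t) (g t))) ->
  measurable_fun setT (fun t => gexp k (F t)).
Proof.
elim: k d T F => [|k IHk] d T F mF /=.
  by apply: (mF _ _ id (fun _ _ => 0)).
refine (measurable_Rintegral_normal_prob _ _
  (fun p => gexp k (fun z => F p.1 (upd k p.2 z))) _).
apply: (IHk _ _ (fun p z => F p.1 (upd k p.2 z))) => d' T' h g mh mg.
apply: (mF _ _ (fun t => (h t).1) (fun t => upd k (h t).2 (g t))).
  exact: measurableT_comp.
by move=> j; rewrite /upd; case: eqP => _ //; exact: measurableT_comp.
Qed.

Lemma measurable_gexp_upd k f : cylinder_measurable f ->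
  measurable_fun setT (fun x => gexp k (fun z => f (upd k x z))).
Proof.
move=> mf; apply: (@measurable_gexp _ _ _ (fun x z => f (upd k x z))).
move=> d' T' h g mh mg; apply: mf => j.
by rewrite /upd; case: eqP.
Qed.

Lemma cylinder_measurable_upd k x f :
  cylinder_measurable f -> cylinder_measurable (fun z => f (upd k x z)).
Proof.
move=> mf d T g mg; apply: mf => j; rewrite /upd; case: eqP => // _.
Qed.

Lemma sum_upd (k : nat) (x : R) z (c : nat -> R -> R) :
  \sum_(j < k.+1) c j (upd k x z j) = \sum_(j < k) c j (z j) + c k x.
Proof.
rewrite big_ord_recr /= /upd eqxx; congr (_ + _).
by apply: eq_bigr => i _; rewrite ltn_eqF.
Qed.

Lemma measurable_quadratic (a b c : R) :
  measurable_fun [set: R] (fun x => a + b * x + c * x ^+ 2).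
Proof.
apply: measurable_funD; last by apply: measurable_funM => //; exact: measurable_funX.
by apply: measurable_funD => //; exact: measurable_funM.
Qed.

(** Each integration replaces one [z j ^+ 2] by a second moment, which is at most 1. *)
Lemma gexp_bound k f (a b : R) : cylinder_measurable f -> 0 <= b ->
  (forall z, `|f z| <= a + b * \sum_(j < k) z j ^+ 2) ->
  `|gexp k f| <= a + b * k%:R.
Proof.
elim: k f a => [|k IHk] f a mf b0 fab /=.
  by have := fab (fun _ => 0); rewrite big_ord0.
have bound x : `|gexp k (fun z => f (upd k x z))| <= (a + b * k%:R) + b * x ^+ 2.
  rewrite addrAC; apply: IHk => //; first exact: cylinder_measurable_upd.
  move=> z; apply: (le_trans (fab _)).
  by rewrite (sum_upd k x z (fun _ y => y ^+ 2)) mulrDr addrA addrAC.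
have mg := measurable_gexp_upd k f mf.
have ig := normal_prob_integrable_quad _ _ _ mg bound.
apply: (le_trans (le_normr_Rintegral measurableT ig)).
apply: (@le_trans _ _ (\int[N]_x (a + b * k%:R + 0 * x + b * x ^+ 2))).
  apply: le_Rintegral => //.
  - apply: (@normal_prob_integrable_quad _ _ (a + b * k%:R) b) => [|x].
      exact: measurableT_comp.
    by rewrite normr_id.
  - apply: (@normal_prob_integrable_quad _ _ (a + b * k%:R) b) => [|x].
      exact: measurable_quadratic.
    rewrite mul0r addr0 ger0_norm// (le_trans _ (bound x))//.
  - by move=> x _; rewrite mul0r addr0.
rewrite Rintegral_normal_prob_quad mul0r addr0 -natr1 mulrDr mulr1 addrA lerD2l.
by rewrite ler_piMr// Rintegral_normal_prob_sqr_le1.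
Qed.

Lemma gexpable_upd k x f :
  gexpable k.+1 f -> gexpable k (fun z => f (upd k x z)).
Proof.
move=> [mf [a [b [b0 fab]]]]; split; first exact: cylinder_measurable_upd.
exists (a + b * x ^+ 2), b; split => // z; apply: (le_trans (fab _)).
by rewrite (sum_upd k x z (fun _ y => y ^+ 2)) mulrDr addrA addrAC.
Qed.

Lemma gexpable_integrable k f : gexpable k.+1 f ->
  N.-integrable setT (EFin \o (fun x => gexp k (fun z => f (upd k x z)))).
Proof.
move=> [mf [a [b [b0 fab]]]].
apply: (@normal_prob_integrable_quad _ _ (a + b * k%:R) b).
  exact: measurable_gexp_upd.
move=> x; rewrite addrAC; apply: gexp_bound => //.
  exact: cylinder_measurable_upd.
move=> z; apply: (le_trans (fab _)).
by rewrite (sum_upd k x z (fun _ y => y ^+ 2)) mulrDr addrA addrAC.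
Qed.

(** * Linearity and monotonicity of the iterated expectation *)

Lemma gexpS k (f : (nat -> R) -> R) :
  gexp k.+1 f = \int[N]_x gexp k (fun z => f (upd k x z)).
Proof. by []. Qed.

Lemma gexpD k f g : gexpable k f -> gexpable k g ->
  gexp k (fun z => f z + g z) = gexp k f + gexp k g.
Proof.
elim: k f g => [//|k IHk] f g gf gg; rewrite !gexpS.
rewrite -RintegralD//; [|exact: gexpable_integrable..].
by apply: eq_Rintegral => x _; rewrite IHk//; exact: gexpable_upd.
Qed.

Lemma gexpZ k c f : gexpable k f ->
  gexp k (fun z => c * f z) = c * gexp k f.
Proof.
elim: k f => [//|k IHk] f gf; rewrite !gexpS.
rewrite -RintegralZl//; last exact: gexpable_integrable.
by apply: eq_Rintegral => x _; rewrite IHk//; exact: gexpable_upd.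
Qed.

Lemma ler_gexp k f g : gexpable k f -> gexpable k g ->
  (forall z, f z <= g z) -> gexp k f <= gexp k g.
Proof.
elim: k f g => [|k IHk] f g gf gg fg; first exact: fg.
rewrite !gexpS.
apply: le_Rintegral => //; [exact: gexpable_integrable..|].
by move=> x _; apply: IHk => //; exact: gexpable_upd.
Qed.

Lemma gexp_ge0 k (f : (nat -> R) -> R) : (forall z, 0 <= f z) -> 0 <= gexp k f.
Proof.
elim: k f => [|k IHk] f f0; first exact: f0.
rewrite gexpS.
by apply: Rintegral_ge0 => x _; exact: IHk.
Qed.

Lemma gexpable_cst k (c : R) : gexpable k (fun _ => c).
Proof.
split; first by move=> d T g _.
by exists `|c|, 0; split => // z; rewrite mul0r addr0.
Qed.

Lemma gexp_cst k (c : R) : gexp k (fun _ => c) = c.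
Proof.
elim: k => [//|k IHk]; rewrite gexpS /=.
under eq_Rintegral do rewrite IHk.
exact: Rintegral_normal_prob_cst.
Qed.

Lemma gexpableD k f g : gexpable k f -> gexpable k g ->
  gexpable k (fun z => f z + g z).
Proof.
move=> [mf [a [b [b0 fab]]]] [mg [a' [b' [b0' fab']]]]; split.
  by move=> d T h mh; apply: measurable_funD; [exact: mf|exact: mg].
exists (a + a'), (b + b'); split; first exact: addr_ge0.
move=> z; rewrite mulrDl addrACA (le_trans (ler_normD _ _))//.
by rewrite lerD.
Qed.

Lemma gexpableZ k c f : gexpable k f -> gexpable k (fun z => c * f z).
Proof.
move=> [mf [a [b [b0 fab]]]]; split.
  by move=> d T h mh; apply: measurable_funM => //; exact: mf.
exists (`|c| * a), (`|c| * b); split; first exact: mulr_ge0.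
by move=> z; rewrite -mulrA -mulrDr normrM ler_wpM2l.
Qed.

Lemma gexpable_sum k (I : Type) (r : seq I) (f : I -> (nat -> R) -> R) :
  (forall i, gexpable k (f i)) -> gexpable k (fun z => \sum_(i <- r) f i z).
Proof.
move=> gf; elim: r => [|i r IHr].
  by under eq_fun do rewrite big_nil; exact: gexpable_cst.
by under eq_fun do rewrite big_cons; exact: gexpableD.
Qed.

Lemma gexp_sum k (I : Type) (r : seq I) (f : I -> (nat -> R) -> R) :
  (forall i, gexpable k (f i)) ->
  gexp k (fun z => \sum_(i <- r) f i z) = \sum_(i <- r) gexp k (f i).
Proof.
move=> gf; elim: r => [|i r IHr].
  by under eq_fun do rewrite big_nil; rewrite big_nil gexp_cst.
under eq_fun do rewrite big_cons.
by rewrite gexpD// ?big_cons ?IHr//; exact: gexpable_sum.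
Qed.

Lemma gexpable_bounded k f (a : R) : cylinder_measurable f ->
  (forall z, `|f z| <= a) -> gexpable k f.
Proof.
by move=> mf fa; split => //; exists a, 0; split => // z; rewrite mul0r addr0.
Qed.

(** * Second moments of affine forms *)

Lemma cylinder_measurable_affine k (a : R) (b : nat -> R) :
  cylinder_measurable (fun z => a + \sum_(j < k) b j * z j).
Proof.
move=> d T g mg; apply: measurable_funD => //.
by apply: measurable_sum => j; exact: measurable_funM.
Qed.

(** Cauchy-Schwarz for the vectors [(a, b)] and [(1, z)], by induction on the dimension. *)
Lemma sqr_affine_le k (a : R) (b z : nat -> R) :
  (a + \sum_(j < k) b j * z j) ^+ 2 <=
  (a ^+ 2 + \sum_(j < k) b j ^+ 2) * (1 + \sum_(j < k) z j ^+ 2).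
Proof.
elim: k => [|k IHk]; first by rewrite !big_ord0 !addr0 mulr1.
rewrite !big_ord_recr /=.
set s := \sum_(j < k) b j * z j in IHk *.
set B := \sum_(j < k) b j ^+ 2 in IHk *.
set Z := \sum_(j < k) z j ^+ 2 in IHk *.
rewrite !addrA.
have B0 : 0 <= B by apply: sumr_ge0 => j _; exact: sqr_ge0.
have Z0 : 0 <= Z by apply: sumr_ge0 => j _; exact: sqr_ge0.
move: (a + s) IHk => u; move: (b k) (z k) => x y.
have : 0 <= a ^+ 2 + B by rewrite addr_ge0 ?sqr_ge0.
have : 0 <= 1 + Z by rewrite addr_ge0.
move: (a ^+ 2 + B) (1 + Z) => P Q Q0 P0 uPQ.
suff h : 2 * u * (x * y) <= P * y ^+ 2 + Q * x ^+ 2.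
  rewrite -subr_ge0; apply: (@le_trans _ _ ((P * Q - u ^+ 2) +
    (P * y ^+ 2 + Q * x ^+ 2 - 2 * u * (x * y)))).
    by rewrite addr_ge0// subr_ge0.
  by rewrite le_eqVlt; apply/orP; left; apply/eqP; ring.
(* For [P > 0], [P] times the gap in [h] equals [(P * y - u * x) ^+ 2 + x ^+ 2 * (P * Q - u ^+ 2)];
   for [P = 0] also [u = 0]. *)
have P2 := sqr_ge0 (P * y - u * x).
have [P1|P1] := ltP 0 P.
  rewrite -(ler_pM2l P1).
  have : (x ^+ 2) * (P * Q - u ^+ 2) >= 0 by rewrite mulr_ge0 ?sqr_ge0// subr_ge0.
  nra.
have {P1}P1 : P = 0 by apply/eqP; rewrite eq_le P1 P0.
have u0 : u = 0.
  apply/eqP; rewrite -sqrf_eq0 eq_le sqr_ge0 andbT.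
  by rewrite (le_trans uPQ)// P1 mul0r.
by rewrite u0 P1 mulr0 mul0r mul0r add0r mulr_ge0 ?sqr_ge0.
Qed.

Lemma gexpable_affine_sqr k (a : R) (b : nat -> R) :
  gexpable k (fun z => (a + \sum_(j < k) b j * z j) ^+ 2).
Proof.
split.
  move=> d T g mg; apply: measurable_funX.
  exact: (cylinder_measurable_affine k a b _ _ _ mg).
pose c := a ^+ 2 + \sum_(j < k) b j ^+ 2; exists c, c; split.
  by rewrite addr_ge0 ?sqr_ge0 ?sumr_ge0// => j _; exact: sqr_ge0.
move=> z; rewrite ger0_norm ?sqr_ge0//.
by apply: (le_trans (sqr_affine_le _ _ _ _)); rewrite mulrDr mulr1.
Qed.

(** The constant [a] is general because fixing the last coordinate turns it into [a + b k * x].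
    Integrating over [x] then kills the cross term, the mean being 0. *)
Lemma gexp_affine_sqr k (a : R) (b : nat -> R) :
  gexp k (fun z => (a + \sum_(j < k) b j * z j) ^+ 2) <=
  a ^+ 2 + \sum_(j < k) b j ^+ 2.
Proof.
elim: k a => [|k IHk] a; first by rewrite /= !big_ord0 !addr0.
have gS := gexpable_affine_sqr k.+1 a b.
pose S := \sum_(j < k) b j ^+ 2.
rewrite gexpS.
apply: (@le_trans _ _
  (\int[N]_x ((a ^+ 2 + S) + 2 * a * b k * x + b k ^+ 2 * x ^+ 2))).
  apply: le_Rintegral => //; first exact: (gexpable_integrable k _ gS).
  - apply: (@normal_prob_integrable_quad _ _ (2 * a ^+ 2 + S) (2 * b k ^+ 2)).
      exact: (measurable_quadratic (a ^+ 2 + S) (2 * a * b k) (b k ^+ 2)).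
    move=> x.
    have := sqr_ge0 (a - b k * x); have := sqr_ge0 (a + b k * x).
    have S0 : 0 <= S by apply: sumr_ge0 => j _; exact: sqr_ge0.
    rewrite !sqrrD !exprMn ler_norml => h1 h2; apply/andP; split; nra.
  - move=> x _; rewrite [leRHS](_ : _ = (a + b k * x) ^+ 2 + S); last by ring.
    apply: le_trans (IHk _); rewrite le_eqVlt; apply/orP; left; apply/eqP.
    congr gexp; apply/funext => z.
    by rewrite (sum_upd k x z (fun j y => b j * y)) addrAC addrA.
rewrite Rintegral_normal_prob_quad Rintegral_normal_prob_id mulr0 addr0.
rewrite big_ord_recr /= addrA lerD2l ler_piMr ?sqr_ge0//.
exact: Rintegral_normal_prob_sqr_le1.
Qed.

End GaussianExpectation.

(** * Bounds on the hyperbolic tangent *)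

Section Tanh.
Context {R : realType}.
Implicit Types x : R.

Lemma expRD_expRN_gt0 x : 0 < expR x + expR (- x).
Proof. by rewrite addr_gt0 ?expR_gt0. Qed.

Lemma tanhRN x : tanhR (- x) = - tanhR x.
Proof. by rewrite /tanhR opprK -mulNr opprB (addrC (expR (- x)) (expR x)). Qed.

Lemma normr_tanhR_le1 x : `|tanhR x| <= 1.
Proof.
rewrite normrM normfV (gtr0_norm (expRD_expRN_gt0 x)) ler_pdivrMr ?expRD_expRN_gt0// mul1r.
rewrite ler_norml; have := expR_gt0 x; have := expR_gt0 (- x); lra.
Qed.

Lemma tanhR_ge0 x : 0 <= x -> 0 <= tanhR x.
Proof.
move=> x0; rewrite divr_ge0 ?(ltW (expRD_expRN_gt0 x))// subr_ge0 ler_expR; lra.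
Qed.

Lemma tanhR_le x : 0 <= x -> tanhR x <= x.
Proof.
move=> x0; rewrite ler_pdivrMr ?expRD_expRN_gt0//.
(* Multiplied by [expR x], the claim becomes [h 0 <= h x], where [h 0 = -1]. *)
pose h (y : R) := (y - 1) * expR (2 * y) + y.
have dh (y : R) : is_derive y 1 h ((2 * y - 1) * expR (2 * y) + 1).
  rewrite /h.
  have de : is_derive y 1 (expR \o ( *%R 2)) (expR (2 * y) * 2).
    apply: is_derive1_comp; apply: is_derive_eq.
    exact: mulr1.
  apply: is_derive_eq; rewrite /GRing.scale/=; ring.
have : h 0 <= h x.
  have ch : continuous h.
    by move=> y; apply/differentiable_continuous/derivable1_diffP; have [] := dh y.
  apply: (@ger0_derive1_ndecr _ h 0 x) => //.
  - move=> y _; rewrite derive1E; have [_ ->] := dh y.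
    (* The derivative is nonnegative because [1 - 2 * y <= expR (- (2 * y))]. *)
    have := expR_ge1Dx (- (2 * y)).
    rewrite -(ler_pM2r (expR_gt0 (2 * y))) -expRD addNr expR0; lra.
  - exact: continuous_subspaceT.
rewrite /h mulr0 expR0 sub0r mulr1 addr0 => hx.
rewrite -(ler_pM2r (expR_gt0 x)) -mulrA !mulrDl mulNr -!expRD addNr expR0.
by rewrite -(mulr2n x) -mulr_natl; lra.
Qed.

Lemma sqr_tanhR_le x : tanhR x ^+ 2 <= x ^+ 2.
Proof.
wlog x0 : x / 0 <= x.
  move=> h; have [/h//|x0] := leP 0 x.
  by rewrite -(sqrrN x) -(sqrrN (tanhR x)) -tanhRN; apply: h; lra.
by rewrite lerXn2r ?nnegrE ?tanhR_ge0// tanhR_le.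
Qed.

Lemma tanhR_double x : tanhR (2 * x) = 2 * tanhR x / (1 + tanhR x ^+ 2).
Proof.
rewrite /tanhR mulr_natl mulr2n opprD !expRD.
have := expR_gt0 x; have := expR_gt0 (- x).
move: (expR x) (expR (- x)) => u v v0 u0; field.
apply/andP; split.
- have := sqr_ge0 u; have := sqr_ge0 (u - v); nra.
- nra.
Qed.

(* The double-angle formula turns [tanh^2 y <= y^2] into a bound with a
   strictly negative quartic term at the origin. *)
Lemma sqr_tanhR_le_frac x : tanhR x ^+ 2 * (1 + x ^+ 2 / 2) <= x ^+ 2.
Proof.
have [y ->] : exists y, x = 2 * y by exists (x / 2); field.
rewrite tanhR_double; move: (sqr_tanhR_le y) (sqr_ge0 (tanhR y)).
move: (tanhR y) => t; rewrite !exprMn exprVn.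
move: (y ^+ 2) (t ^+ 2) => v u uv u0.
have u1 : 0 < (1 + u) ^+ 2 by rewrite exprn_gt0//; lra.
(* With [v = y ^+ 2] and [u = tanhR y ^+ 2], the numerator is nonnegative since [u <= v]. *)
rewrite mulrAC -subr_ge0 (_ : _ - _ =
  4 * (v - u + v * u ^+ 2) / (1 + u) ^+ 2); last by field; rewrite ?gt_eqF//; lra.
by rewrite divr_ge0 ?(ltW u1)// mulr_ge0// addr_ge0 ?subr_ge0 ?mulr_ge0 ?sqr_ge0// (le_trans u0).
Qed.

(* The right-hand side is the tangent line at [m], evaluated at [x ^+ 2], of the
   concave map [u |-> u / (1 + u / 2)]. *)
Lemma sqr_tanhR_tangent x (m : R) : 0 <= m ->
  tanhR x ^+ 2 <= (x ^+ 2 + m ^+ 2 / 2) / (1 + m / 2) ^+ 2.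
Proof.
move=> m0; rewrite ler_pdivlMr; last by rewrite exprn_gt0//; lra.
have := sqr_tanhR_le_frac x; have := sqr_ge0 x; have := sqr_ge0 (tanhR x).
move: (tanhR x ^+ 2) (x ^+ 2) => t s t0 s0 ts.
have s1 : 0 < 1 + s / 2 by lra.
rewrite -(ler_pM2r s1) mulrAC.
apply: (@le_trans _ _ (s * (1 + m / 2) ^+ 2)).
  by rewrite ler_wpM2r// sqr_ge0.
rewrite -subr_ge0 (_ : _ - _ = (s - m) ^+ 2 / 2); last by field.
by rewrite divr_ge0 ?sqr_ge0.
Qed.

Lemma measurable_tanhR : measurable_fun [set: R] (@tanhR R).
Proof.
apply: continuous_measurable_fun => x.
have ce (y : R) : {for y, continuous (@expR R)} by exact: continuous_expR.
have cN : (expR (- y) @[y --> x] --> expR (- x)).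
  by apply: (continuous_comp (@oppr_continuous _ R^o x)); exact: ce.
apply: cvgM; first by apply: cvgB => //; exact: ce.
by apply: cvgV; [rewrite gt_eqF ?expRD_expRN_gt0|apply: cvgD => //; exact: ce].
Qed.

End Tanh.

(** * Propagation of the covariance *)

Section Propagation.
Context {R : realType}.

(** Nonnegativity of the weighted variance of [w], scaled by powers of the total weight to avoid
    division. *)
Lemma weighted_cauchy_schwarz (I : finType) (a w : I -> R) :
  (forall j, 0 <= a j) -> 0 < \sum_j a j ->
  (\sum_j a j * w j) ^+ 2 <= (\sum_j a j) * \sum_j a j * w j ^+ 2.
Proof.
move=> a0; set P := \sum_j a j; set S := \sum_j a j * w j => P0.
set Q := \sum_j a j * w j ^+ 2.
have : 0 <= \sum_j a j * (P * w j - S) ^+ 2.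
  by apply: sumr_ge0 => j _; rewrite mulr_ge0 ?sqr_ge0.
have -> : \sum_j a j * (P * w j - S) ^+ 2 = P * (P * Q - S ^+ 2).
  rewrite (eq_bigr (fun j => P ^+ 2 * (a j * w j ^+ 2) +
    (- 2 * P * S * (a j * w j) + S ^+ 2 * a j))) => [|j _]; last by ring.
  rewrite !big_split /= -!mulr_sumr -/P -/S -/Q; ring.
by rewrite pmulr_rge0// subr_ge0.
Qed.

Lemma AhatE n (A : 'M[R]_n) i j : Ahat A i j =
  (Num.sqrt (deg A i + 1))^-1 * (A i j + (i == j)%:R) *
  (Num.sqrt (deg A j + 1))^-1.
Proof. by rewrite /Ahat /= mul_mx_diag mul_diag_mx !mxE. Qed.

Lemma Ahat_tr n (A : 'M[R]_n) : A^T = A -> (Ahat A)^T = Ahat A.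
Proof.
move=> symA; apply/matrixP => i j; rewrite mxE !AhatE.
have -> : A j i = A i j by rewrite -{1}symA mxE.
by rewrite [j == i]eq_sym; ring.
Qed.

(* Schur test: the row sums of [A + I] are the entries of [D + I]. *)
Lemma Ahat_contraction n (A : 'M[R]_n) (v : 'I_n -> R) :
  A^T = A -> (forall i j, 0 <= A i j) ->
  \sum_i (\sum_j Ahat A i j * v j) ^+ 2 <= \sum_j v j ^+ 2.
Proof.
move=> symA A0.
pose a i j := A i j + (i == j)%:R.
have a0 i j : 0 <= a i j by rewrite addr_ge0.
have aC i j : a i j = a j i by rewrite /a -{1}symA mxE eq_sym.
have sa i : \sum_j a i j = deg A i + 1.
  rewrite big_split /= (bigD1 i (F := fun j => (i == j)%:R))//= eqxx.
  by rewrite [X in _ + (_ + X)]big1 ?addr0// => j /negbTE; rewrite eq_sym => ->.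
have d0 i : 0 < deg A i + 1.
  by rewrite ltr_wpDl// sumr_ge0.
pose s i := (Num.sqrt (deg A i + 1))^-1.
have s2 i : s i ^+ 2 * (deg A i + 1) = 1.
  by rewrite exprVn sqr_sqrtr ?(ltW (d0 i))// mulVf ?gt_eqF.
apply: (@le_trans _ _ (\sum_i \sum_j a i j * (s j * v j) ^+ 2)).
  apply: ler_sum => i _.
  have -> : \sum_j Ahat A i j * v j = s i * \sum_j a i j * (s j * v j).
    by rewrite mulr_sumr; apply: eq_bigr => j _; rewrite AhatE /s /a; ring.
  (* The factor [s i ^+ 2] cancels the row sum that Cauchy-Schwarz produces. *)
  rewrite exprMn -[leRHS]mul1r -[X in _ <= X * _](s2 i) -[leRHS]mulrA ler_wpM2l ?sqr_ge0// -sa.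
  by apply: weighted_cauchy_schwarz => //; rewrite sa.
(* By symmetry the column sums are also [deg A j + 1], which cancels [s j ^+ 2]. *)
rewrite exchange_big /=; apply: ler_sum => j _.
rewrite -mulr_suml (eq_bigr (a j)) => [|i _]; last exact: aC.
by rewrite sa exprMn mulrA [X in X * _]mulrC s2 mul1r.
Qed.

Lemma frob2_ge0 m k (M : 'M[R]_(m, k)) : 0 <= frob2 M.
Proof. by apply: sumr_ge0 => i _; apply: sumr_ge0 => j _; exact: sqr_ge0. Qed.

Lemma frob2_gt0 m k (M : 'M[R]_(m, k)) : M != 0 -> 0 < frob2 M.
Proof.
move=> M0; rewrite lt_def frob2_ge0 andbT; apply: contra M0 => /eqP h.
apply/eqP/matrixP => i j; rewrite mxE; apply/eqP; rewrite -sqrf_eq0.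
have /psumr_eq0P/(_ h i isT) : forall i, true -> 0 <= \sum_j M i j ^+ 2.
  by move=> i' _; apply: sumr_ge0 => j' _; exact: sqr_ge0.
by move/psumr_eq0P => -> // j' _; exact: sqr_ge0.
Qed.

Lemma frob2_mxtrace m k (M : 'M[R]_(m, k)) : frob2 M = \tr (M *m M^T).
Proof.
by apply: eq_bigr => i _; rewrite mxE; apply: eq_bigr => j _; rewrite mxE expr2.
Qed.

Lemma frob2_Ahat_le n d (A : 'M[R]_n) (X : 'M[R]_(n, d)) :
  A^T = A -> (forall i j, 0 <= A i j) -> frob2 (Ahat A *m X) <= frob2 X.
Proof.
move=> symA A0; rewrite /frob2 exchange_big /= [leRHS]exchange_big /=.
apply: ler_sum => c _.
under eq_bigr do rewrite mxE.
exact: (Ahat_contraction _ A (fun j => X j c) symA A0).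
Qed.

(** A genuine factor has squared norm [\tr S]; the default factor 0 is covered by [0 <= c]. *)
Lemma frob2_cov_factor_le n (S : 'M[R]_n) (c : R) :
  0 <= c -> \tr S <= c -> frob2 (cov_factor S) <= c.
Proof.
move=> c0; rewrite /cov_factor; case: pselect => [h|_ _].
  by rewrite frob2_mxtrace; case: cid => B /= ->.
by rewrite frob2_mxtrace mul0mx mxtrace0.
Qed.

(** Rows are extended by zero to all of [nat], the index type of the coefficients in the affine-form
    lemmas. *)
Definition row_fun m k (M : 'M[R]_(m, k)) (i : 'I_m) (l : nat) : R :=
  oapp (M i) 0 (insub l).

Lemma row_funE m k (M : 'M[R]_(m, k)) i (l : 'I_k) : row_fun _ _ M i l = M i l.
Proof. by rewrite /row_fun valK. Qed.

Lemma mul_col_ofE m (M : 'M[R]_m) i z :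
  (M *m col_of m z) i 0 = 0 + \sum_(l < m) row_fun _ _ M i l * z l.
Proof.
by rewrite mxE add0r; apply: eq_bigr => l _; rewrite mxE row_funE.
Qed.

Lemma cylinder_measurable_tanh_row n (B : 'M[R]_n) i :
  cylinder_measurable (fun z => tanhR ((B *m col_of n z) i 0)).
Proof.
move=> d T g mg; apply: measurableT_comp; first exact: measurable_tanhR.
under eq_fun do rewrite mul_col_ofE.
exact: (cylinder_measurable_affine n 0 (row_fun _ _ B i) _ _ _ mg).
Qed.

Lemma gexpable_tanhM n (B : 'M[R]_n) i j :
  gexpable n (fun z => tanhR ((B *m col_of n z) i 0) *
                       tanhR ((B *m col_of n z) j 0)).
Proof.
apply: (gexpable_bounded _ _ 1) => [d T g mg|z].
  by apply: measurable_funM; exact: (cylinder_measurable_tanh_row _ B).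
by rewrite normrM mulr_ile1 ?normr_tanhR_le1.
Qed.

(** By linearity the trace is the expectation of the squared norm of [Ahat A] applied to [tanh h],
    and the contraction bound applies for each [z]. *)
Lemma mxtrace_Ahat_Gtanh_le n (A S : 'M[R]_n) :
  A^T = A -> (forall i j, 0 <= A i j) ->
  \tr (Ahat A *m Gtanh S *m Ahat A) <=
  gexp n (fun z => \sum_j tanhR ((cov_factor S *m col_of n z) j 0) ^+ 2).
Proof.
move=> symA A0.
pose s j z := tanhR ((cov_factor S *m col_of n z) j 0).
have gs j k : gexpable n (fun z => s j z * s k z) by exact: gexpable_tanhM.
have gs1 i j k : gexpable n (fun z => Ahat A i j * Ahat A k i * (s j z * s k z)).
  exact: gexpableZ.
have gs2 i k : gexpable n (fun z =>
    \sum_j Ahat A i j * Ahat A k i * (s j z * s k z)).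
  exact: gexpable_sum.
have gs3 i : gexpable n (fun z =>
    \sum_k \sum_j Ahat A i j * Ahat A k i * (s j z * s k z)).
  exact: gexpable_sum.
have -> : \tr (Ahat A *m Gtanh S *m Ahat A) = gexp n (fun z =>
    \sum_i \sum_k \sum_j Ahat A i j * Ahat A k i * (s j z * s k z)).
  rewrite gexp_sum//; apply: eq_bigr => i _.
  rewrite mxE gexp_sum//; apply: eq_bigr => k _.
  rewrite gexp_sum// mxE mulr_suml; apply: eq_bigr => j _.
  by rewrite gexpZ// !mxE mulrAC.
apply: ler_gexp.
- exact: gexpable_sum.
- by apply: gexpable_sum => j; exact: gs.
- move=> z; apply: le_trans (Ahat_contraction _ A (s ^~ z) symA A0).
  apply: ler_sum => i _; rewrite expr2 mulr_suml exchange_big /=.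
  apply: ler_sum => j _; rewrite mulr_sumr; apply: ler_sum => k _.
  rewrite -[Ahat A k i](_ : Ahat A i k = _); last by rewrite -{1}Ahat_tr// mxE.
  by rewrite le_eqVlt; apply/orP; left; apply/eqP; ring.
Qed.

(** The tangent-line bound is affine in the squares of the coordinates of [B z], whose second
    moments are at most the squared row norms of [B]. The tangency point [m] stays free. *)
Lemma gexp_sqr_tanh_le n (B : 'M[R]_n) (m : R) : 0 <= m ->
  gexp n (fun z => \sum_j tanhR ((B *m col_of n z) j 0) ^+ 2) <=
  (frob2 B + n%:R * (m ^+ 2 / 2)) / (1 + m / 2) ^+ 2.
Proof.
move=> m0.
pose q j (z : nat -> R) := (0 + \sum_(l < n) row_fun _ _ B j l * z l) ^+ 2.
have gq j : gexpable n (q j) by exact: gexpable_affine_sqr.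
pose c := ((1 + m / 2) ^+ 2)^-1.
have c0 : 0 <= c by rewrite invr_ge0 sqr_ge0.
have gq1 j : gexpable n (fun z => q j z + m ^+ 2 / 2).
  by apply: gexpableD => //; exact: gexpable_cst.
have gq2 j : gexpable n (fun z => c * (q j z + m ^+ 2 / 2)).
  exact: gexpableZ.
apply: (@le_trans _ _ (gexp n (fun z => \sum_j c * (q j z + m ^+ 2 / 2)))).
  apply: ler_gexp; [|exact: gexpable_sum|].
    by apply: gexpable_sum => j; exact: gexpable_tanhM.
  move=> z; apply: ler_sum => j _.
  by rewrite /q -mul_col_ofE mulrC; exact: sqr_tanhR_tangent.
rewrite gexp_sum// [leRHS]mulrC.
rewrite (eq_bigr (fun j => c * (gexp n (q j) + m ^+ 2 / 2))) => [|j _]; last first.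
  rewrite gexpZ// gexpD//; last exact: gexpable_cst.
  by rewrite gexp_cst.
rewrite -mulr_sumr ler_wpM2l// big_split /= sumr_const card_ord mulr_natl lerD2r.
apply: ler_sum => j _; apply: (le_trans (gexp_affine_sqr _ _ _)).
rewrite expr0n /= add0r le_eqVlt; apply/orP; left; apply/eqP.
by apply: eq_bigr => l _; rewrite row_funE.
Qed.

(** * From the covariance factor to the metric *)

(** Column [c] of [H] reads only the coordinates from [c * n] to [c * n + n - 1]; elsewhere its
    coefficients vanish. A general [F] serves both the linear form and its squared norm. *)
Lemma sum_block n C (c : 'I_C) m (M : 'M[R]_(m, n)) i (F : R -> nat -> R) :
  (forall p, F 0 p = 0) ->
  \sum_(p < n * C)
    F (if (c * n <= p)%N then row_fun _ _ M i (p - c * n) else 0) p =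
  \sum_(j < n) F (M i j) (c * n + j)%N.
Proof.
move=> F0; pose G p := F (if (c * n <= p)%N then row_fun _ _ M i (p - c * n) else 0) p.
have le1 : (c * n <= c.+1 * n)%N by rewrite leq_mul2r leqnSn orbT.
have le2 : (c.+1 * n <= n * C)%N by rewrite [leqRHS]mulnC leq_mul2r ltn_ord orbT.
rewrite -(big_mkord xpredT G) (big_cat_nat (n := c * n)) ?(leq_trans le1)//=.
rewrite (big_cat_nat (m := c * n) (n := c.+1 * n))//=.
rewrite big_nat big1 ?add0r => [|p /andP[_ pc]]; last first.
  by rewrite /G leqNgt pc.
rewrite [X in _ + X]big_nat [X in _ + X]big1 ?addr0 => [|p /andP[pc _]]; last first.
  rewrite /G (leq_trans le1 pc) /row_fun insubF ?F0//.
  by apply/negbTE; rewrite -leqNgt leq_subRL ?(leq_trans le1)// addnC -mulSn.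
rewrite -[X in index_iota X _]add0n big_addn mulSn addnK big_mkord.
apply: eq_bigr => j _; rewrite /G leq_addl addnK row_funE addnC//.
Qed.

(** Each entry of [H] is a linear form in the [n * C] coordinates, with second moment at most the
    squared norm of a row of the factor; the [C] columns contribute equally. *)
Lemma FSP_le n d0 C (A : 'M[R]_n) (X : 'M[R]_(n, d0)) (sw2 : R) L :
  FSP A X C sw2 L <=
  C%:R * frob2 (cov_factor (Sigma A X sw2 L)) / frob2 X.
Proof.
rewrite /FSP; set B := cov_factor _.
pose b i (c : 'I_C) (p : nat) : R :=
  if (c * n <= p)%N then row_fun _ _ B i (p - c * n) else 0.
pose q i c (z : nat -> R) := (0 + \sum_(p < n * C) b i c p * z p) ^+ 2.
have gq i c : gexpable (n * C) (q i c) by exact: gexpable_affine_sqr.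
have gqs i : gexpable (n * C) (fun z => \sum_c q i c z) by exact: gexpable_sum.
rewrite [X in gexp _ X](_ : _ =
    (fun z => (frob2 X)^-1 * \sum_i \sum_c q i c z)); last first.
  apply/funext => z; rewrite mulrC; congr (_ * _).
  apply: eq_bigr => i _; apply: eq_bigr => c _; rewrite !mxE; congr (_ ^+ 2).
  rewrite add0r (sum_block _ _ c _ B i (fun x p => x * z p)); last first.
    by move=> p; rewrite mul0r.
  by apply: eq_bigr => j _; rewrite mxE.
rewrite gexpZ; last exact: gexpable_sum.
rewrite mulrC ler_wpM2r ?invr_ge0 ?frob2_ge0// gexp_sum// mulr_sumr.
apply: ler_sum => i _; rewrite gexp_sum//.
rewrite mulr_natl -[X in _ *+ X]card_ord -sumr_const; apply: ler_sum => c _.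
apply: (le_trans (gexp_affine_sqr _ _ _)).
by rewrite expr0n add0r (sum_block _ _ c _ B i (fun x _ => x ^+ 2))// => p;
  rewrite expr0n.
Qed.

Lemma FSP_ge0 n d0 C (A : 'M[R]_n) (X : 'M[R]_(n, d0)) (sw2 : R) L :
  0 <= FSP A X C sw2 L.
Proof. by apply: gexp_ge0 => z; rewrite divr_ge0 ?frob2_ge0. Qed.

Lemma frob2_Sigma1_le n d0 (A : 'M[R]_n) (X : 'M[R]_(n, d0)) (sw2 : R) :
  A^T = A -> (forall i j, 0 <= A i j) -> 0 <= sw2 ->
  frob2 (cov_factor (Sigma A X sw2 1)) <= sw2 / d0%:R * frob2 X.
Proof.
move=> symA A0 s0; apply: frob2_cov_factor_le.
  by rewrite mulr_ge0 ?frob2_ge0 ?divr_ge0.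
rewrite /= mxtraceZ ler_wpM2l ?divr_ge0//.
apply: le_trans (frob2_Ahat_le _ _ A X symA A0).
by rewrite frob2_mxtrace trmx_mul Ahat_tr// !mulmxA.
Qed.

Lemma frob2_SigmaS_le n d0 (A : 'M[R]_n) (X : 'M[R]_(n, d0)) (sw2 m : R) l :
  A^T = A -> (forall i j, 0 <= A i j) -> 0 <= sw2 -> 0 <= m ->
  frob2 (cov_factor (Sigma A X sw2 l.+2)) <=
  sw2 * ((frob2 (cov_factor (Sigma A X sw2 l.+1)) + n%:R * (m ^+ 2 / 2)) /
         (1 + m / 2) ^+ 2).
Proof.
move=> symA A0 s0 m0; apply: frob2_cov_factor_le.
  rewrite mulr_ge0// divr_ge0 ?sqr_ge0// addr_ge0 ?frob2_ge0//.
  by rewrite mulr_ge0// divr_ge0 ?sqr_ge0.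
rewrite [Sigma _ _ _ l.+2]/= mxtraceZ ler_wpM2l//.
apply: le_trans (mxtrace_Ahat_Gtanh_le _ _ _ symA A0) _.
exact: gexp_sqr_tanh_le.
Qed.

End Propagation.

(** * Decay of the metric in the critical and subcritical regimes *)

Theorem mainTheorem6 (R : realType) (n d0 C : nat) (A : 'M[R]_n)
  (X : 'M[R]_(n, d0)) (sw2 : R) :
  A^T = A -> (forall i j, A i j = 0 \/ A i j = 1) ->
  X != 0 -> (1 <= C)%N -> 0 < sw2 ->
  (sw2 = 1 -> (fun k => FSP A X C sw2 k.+1) @ \oo --> (0 : R)) /\
  (sw2 < 1 -> forall L : nat, (1 <= L)%N ->
     FSP A X C sw2 L <= C%:R / d0%:R * sw2 ^+ L).
Proof.
move=> symA A01 X0 _ s0.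
have A0 i j : 0 <= A i j by case: (A01 i j) => ->.
have X2 := frob2_gt0 _ _ X X0.
(* A nonzero [X] has at least one row, so dividing by [n] is legitimate. *)
have n0 : (0 < n)%N.
  rewrite lt0n; apply: contra X0 => /eqP n0; apply/eqP/matrixP => i.
  by move: (ltn_ord i); rewrite [X in (_ < X)%N]n0.
(* The index is shifted: [t l] belongs to layer [l + 1], since [Sigma] at 0 is a placeholder. *)
pose t l := frob2 (cov_factor (Sigma A X sw2 l.+1)).
have t0 l : 0 <= t l by exact: frob2_ge0.
have t1 : t 0%N <= sw2 / d0%:R * frob2 X by apply: frob2_Sigma1_le => //; exact: ltW.
have tS l m : 0 <= m ->
    t l.+1 <= sw2 * ((t l + n%:R * (m ^+ 2 / 2)) / (1 + m / 2) ^+ 2).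
  by move=> m0; apply: frob2_SigmaS_le => //; exact: ltW.
split => [s1|slt1 [//|l] _].
  have n1 : 0 < n%:R :> R by rewrite ltr0n.
  pose a : R := (2 * n%:R)^-1.
  have a0 : 0 < a by rewrite invr_gt0 mulr_gt0.
  (* Tangency is taken at the average [m = t l / n]; then [m / 2 = a * t l] and the bound collapses
     to [t l / (1 + a * t l)]. *)
  have rec l : t l.+1 * (1 + a * t l) <= t l.
    have := tS l (t l / n%:R); rewrite divr_ge0 ?t0 ?ler0n// s1 mul1r => /(_ isT).
    have -> : t l / n%:R / 2 = a * t l by rewrite /a; field; rewrite gt_eqF.
    have -> : t l + n%:R * ((t l / n%:R) ^+ 2 / 2) = t l * (1 + a * t l).
      by rewrite /a; field; rewrite gt_eqF.
    have u0 : 0 < 1 + a * t l by rewrite ltr_wpDr ?mulr_ge0// ltW.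
    by rewrite expr2 invfM mulrA mulfK ?gt_eqF// ler_pdivlMr.
  have tdec l : t l <= t 0%N.
    elim: l => // l; apply: le_trans; apply: le_trans (rec l).
    by rewrite ler_peMr// lerDl mulr_ge0// ltW.
  (* In the inductive step, multiplying by [1 + a * t l] and using [rec] leaves
     [a * (l + 1) * t l <= 1 + a * t l]. *)
  have bnd l : a * l%:R * t l <= 1.
    elim: l => [|l IH]; first by rewrite mulr0 mul0r.
    have u0 : 0 < 1 + a * t l by rewrite ltr_wpDr ?mulr_ge0// ltW.
    rewrite -(ler_pM2r u0) mul1r -[leLHS]mulrA.
    apply: (@le_trans _ _ (a * l.+1%:R * t l)).
      by rewrite ler_wpM2l ?rec// mulr_ge0// ltW.
    by rewrite -natr1 mulrDr mulr1 mulrDl lerD2r.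
  (* Here [(k + 1) * t k = k * t k + t k] is at most [a^-1 + t 0], by [bnd] and [tdec]. *)
  pose K := C%:R / frob2 X * (a^-1 + t 0%N).
  apply: (@squeeze_cvgr _ _ _ _ (fun=> 0) (fun k => K * k.+1%:R^-1)).
  - near=> k; rewrite FSP_ge0 /=; apply: (le_trans (FSP_le _ _ _ _ _ _ _)).
    rewrite -/(t k) [leLHS]mulrAC /K -[leRHS]mulrA ler_wpM2l ?divr_ge0 ?(ltW X2)//.
    rewrite ler_pdivlMr ?ltr0n// -natr1 mulrDr mulr1 lerD//.
    by rewrite -(ler_pM2l a0) mulfV ?gt_eqF// mulrCA mulrC.
  - exact: cvg_cst.
  - rewrite -[X in _ --> X](mulr0 K); apply: cvgMr; exact: cvg_harmonic.
have bnd : t l <= sw2 ^+ l.+1 / d0%:R * frob2 X.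
  elim: l => [|l IH]; first by rewrite expr1.
  (* The tangent at the origin, [m = 0], gives [t l.+1 <= sw2 * t l]. *)
  have := tS l 0 (lexx _); rewrite expr0n /= !mul0r mulr0 !addr0 expr1n divr1.
  move=> /le_trans; apply; rewrite exprS -!mulrA ler_wpM2l ?(ltW s0)//.
  by rewrite mulrA.
apply: (le_trans (FSP_le _ _ _ _ _ _ _)); rewrite ler_pdivrMr// -/(t l).
by rewrite -!mulrA ler_wpM2l// (le_trans bnd)// mulrCA mulrA.
Unshelve. all: by end_near. Qed.
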